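(* Let $n\ge3$, $\tau\in[0,\frac\pi2]$, $C_0\in\mathbb R$, and let $A\in\mathtt{Sym}(n)$ be positive definite with $G_\tau(\lambda(A))=C_0$. Suppose $u(x)=U(\frac12x^TAx)$ is a generalized symmetric convex classical solution of $$G_\tau(\lambda(D^2u))=C_0\quad\text{in }\mathbb R^n\setminus\{0\}.$$ Then: (1) if $\tau=0$, then $$u(x)=\int_0^{(x^TAx)^{1/2}}(r^n+c_1)^{\frac1n}\,dr+c_2$$ for some $c_1\ge0$ and $c_2\in\mathbb R$; (2) if $\tau\in(0,\frac\pi2]$, then either $A$ is a multiple of the identity matrix, i.e. $$A=\left(\frac{2b}{1-\exp\left(\frac{2b}{n\sqrt{a^2+1}}C_0\right)}-2b\right)I\ \text{ for }\tau\in(0,\tfrac\pi4),\qquad A=-\frac{\sqrt2\,n}{C_0}I\ \text{ for }\tau=\tfrac\pi4,$$ $$A=\tan\left(\frac{b}{n\sqrt{a^2+1}}C_0+\frac\pi4\right)I\ \text{ for }\tau\in(\tfrac\pi4,\tfrac\pi2),\qquad A=\tan\left(\frac{C_0}{n}\right)I\ \text{ for }\tau=\tfrac\pi2,$$ or $u$ is the quadratic function $\frac12x^TAx$ up to an additive constant $c$.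
   Context: $\mathtt{Sym}(n)$ is the set of real symmetric $n\times n$ matrices; $\lambda(M)=(\lambda_1,\dots,\lambda_n)$ denotes the eigenvalues of $M\in\mathtt{Sym}(n)$; $I$ is the identity matrix. For $\tau\in(0,\frac\pi2]$ put $a=\cot\tau$ and $b=\sqrt{|\cot^2\tau-1|}$. Define $$G_\tau(\lambda)=\begin{cases}\frac1n\sum_{i=1}^n\ln\lambda_i,&\tau=0,\\ \frac{\sqrt{a^2+1}}{2b}\sum_{i=1}^n\ln\frac{\lambda_i}{\lambda_i+2b},&0<\tau<\frac\pi4,\\ -\sqrt2\sum_{i=1}^n\frac1{\lambda_i},&\tau=\frac\pi4,\\ \frac{\sqrt{a^2+1}}{b}\left(\sum_{i=1}^n\arctan\lambda_i-\frac{n\pi}4\right),&\frac\pi4<\tau<\frac\pi2,\\ \sum_{i=1}^n\arctan\lambda_i,&\tau=\frac\pi2.\end{cases}$$ A function $u$ is called generalized symmetric with respect to $A\in\mathtt{Sym}(n)$ if $u(x)$ depends only on the value of $x^TAx$. A convex classical solution is $u\in C^2(\mathbb R^n\setminus\{0\})$ with $D^2u\ge0$ in $\mathbb R^n\setminus\{0\}$ satisfying the equation pointwise (for $\tau\in[0,\frac\pi4]$ the expression being defined forces $D^2u>0$). *)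

(* Defs.v *)
From HB Require Import structures.
From mathcomp Require Import all_boot all_order all_algebra.
From mathcomp Require Import all_classical all_reals all_analysis.

Set Implicit Arguments.
Unset Strict Implicit.
Unset Printing Implicit Defensive.

Import Order.TTheory GRing.Theory Num.Theory.
Import numFieldNormedType.Exports.

Local Open Scope classical_set_scope.
Local Open Scope ring_scope.

Section Matrices.
Context {R : realType} {n : nat}.

Definition quad_form (M : 'M[R]_n) (x : 'cV[R]_n) : R :=
  (x^T *m M *m x) ord0 ord0.

(* Symmetry is stated separately. *)
Definition pos_def (M : 'M[R]_n) : Prop :=
  forall x : 'cV[R]_n, x != 0 -> 0 < quad_form M x.

Definition pos_semidef (M : 'M[R]_n) : Prop :=
  forall x : 'cV[R]_n, 0 <= quad_form M x.

(* [l] lists the eigenvalues of [M] with multiplicity. For symmetric [M] such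
   an [l] exists and is unique up to reordering, to which [G] below is
   insensitive. *)
Definition eigenvalues_of (M : 'M[R]_n) (l : 'I_n -> R) : Prop :=
  char_poly M = \prod_(i < n) ('X - (l i)%:P).

End Matrices.

Section Operator.
Context {R : realType}.
Implicit Type tau : R.

Definition ctan tau : R := cos tau / sin tau.

Definition bcoef tau : R := Num.sqrt `|ctan tau ^+ 2 - 1|.

(* The value is irrelevant for [tau] outside of [0, pi / 2]. *)
Definition G (n : nat) tau (l : 'I_n -> R) : R :=
  let a := ctan tau in let b := bcoef tau in
  if tau == 0 then n%:R^-1 * \sum_(i < n) ln (l i)
  else if tau < pi / 4 then
    Num.sqrt (a ^+ 2 + 1) / (2 * b) * \sum_(i < n) ln (l i / (l i + 2 * b))
  else if tau == pi / 4 then - Num.sqrt 2 * \sum_(i < n) (l i)^-1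
  else if tau < pi / 2 then
    Num.sqrt (a ^+ 2 + 1) / b * (\sum_(i < n) atan (l i) - n%:R * pi / 4)
  else \sum_(i < n) atan (l i).

(* [ln] and inversion are total functions here, so the natural domain of the
   formula for [G] is spelled out. *)
Definition G_defined (n : nat) tau (l : 'I_n -> R) : Prop :=
  let b := bcoef tau in
  if tau == 0 then forall i, 0 < l i
  else if tau < pi / 4 then
    forall i, l i + 2 * b != 0 /\ 0 < l i / (l i + 2 * b)
  else if tau == pi / 4 then forall i, l i != 0
  else True.

(* G_tau(lambda(M)) = C0, including that the left-hand side makes sense. *)
Definition G_eigenvalues_eq (n : nat) tau (M : 'M[R]_n) (C0 : R) : Prop :=
  exists l : 'I_n -> R,
    [/\ eigenvalues_of M l, G_defined tau l & G tau l = C0].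

End Operator.

Section Solutions.
Context {R : realType} {n : nat}.
Implicit Type u : 'cV[R]_n -> R.

Definition pderiv u (i : 'I_n) : 'cV[R]_n -> R :=
  fun x => 'D_(delta_mx i ord0) u x.

Definition hessian u (x : 'cV[R]_n) : 'M[R]_n :=
  \matrix_(i < n, j < n) pderiv (pderiv u i) j x.

(* C^2 on the complement of the origin: twice Frechet differentiable there,
   with continuous second derivatives. Values at the origin play no role. *)
Definition C2_punctured u : Prop :=
  forall x : 'cV[R]_n, x != 0 ->
    [/\ differentiable u x,
        forall i, differentiable (pderiv u i) x &
        forall i j, {for x, continuous (pderiv (pderiv u i) j)}].

Definition convex_classical_solution (tau C0 : R) u : Prop :=
  C2_punctured u /\
  forall x : 'cV[R]_n, x != 0 ->
    pos_semidef (hessian u x) /\ G_eigenvalues_eq tau (hessian u x) C0.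

End Solutions.

(* Main.v *)
Require Import Defs.
From HB Require Import structures.
From mathcomp Require Import all_boot all_order all_algebra.
From mathcomp Require Import all_classical all_reals all_analysis.
From mathcomp Require Import measurable_realfun ring lra.

Set Implicit Arguments.
Unset Strict Implicit.
Unset Printing Implicit Defensive.

Import Order.TTheory GRing.Theory Num.Theory.
Import numFieldNormedType.Exports.

Local Open Scope classical_set_scope.
Local Open Scope ring_scope.

(** Write [s] for half of [x^T A x], [g = U'] and [m = U' + 2 s U''].

    The Hessian of [u] is [g A + U'' (A x)(A x)^T].  Along an eigenvector of
    [A] for the eigenvalue [a_i], the rank-one term only moves the eigenvalue
    [g a_i], so that the spectrum of the Hessian is [a_i m] together with the
    [g a_j], [j <> i] ([hessian_radial_eigenvalues]).  As every value [s > 0] is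
    attained on each of these lines, the equation gives, for each [s] and all
    [i] at once,
    [f (a_i m) + sum_(j <> i) f (g a_j) = sum_j f (a_j)],
    where [G_tau] is, up to an affine change, the sum of [f] over the spectrum.
    This is an ordinary differential equation for [U] when [i] is fixed, and an
    overdetermined system when [A] has two distinct eigenvalues.

    For [tau = 0] the function [f] is the logarithm and all these equations are
    [g^(n-1) m = 1].  In the radial variable [r = sqrt (2 s)], with
    [w r = U (r^2 / 2)], this says that [w'^n - r^n] is constant
    ([slope_first_integral]), and one integration concludes.

    For [tau > 0], suppose that [A] is not a multiple of the identity; being
    symmetric, it has two eigenvalues [p <> q].  Subtracting their equations,
    [f (p m) - f (p g) = f (q m) - f (q g)].  For the logarithmic and for the
    inverse densities this forces [m = g].  For the arctangent there is one
    other possibility, [p m * q g = 1], which makes [f (p m) + f (q g)] equal to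
    the constant [pi / 2]; then the sum of the [f (g a_j)] over the remaining
    indices is prescribed.  There is a remaining index since [n >= 3], and [f] is
    increasing, so this happens for at most one value [g0] of [g].  On the other
    hand [m = g] gives [sum_j f (g a_j) = sum_j f (a_j)], hence [g = 1].  The
    differentiable function [g] therefore takes its values in [{1, g0}], so it
    is constant, which leads back to [m = g] and [g = 1]
    ([profile_slope_eq1]).  Thus [U s = s + c]. *)

(** * Spectra of symmetric matrices and of rank-one perturbations *)

Section LinearAlgebra.
Context {R : realType} {n : nat}.
Implicit Types (A M : 'M[R]_n) (x : 'cV[R]_n) (l a : 'I_n -> R).

Definition normsq x : R := (x^T *m x) ord0 ord0.

Lemma normsqE x : normsq x = \sum_i x i ord0 ^+ 2.
Proof. by rewrite /normsq mxE; apply: eq_bigr => i _; rewrite mxE expr2. Qed.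

Lemma normsq_ge0 x : 0 <= normsq x.
Proof. by rewrite normsqE; apply: sumr_ge0 => i _; exact: sqr_ge0. Qed.

Lemma normsq_eq0 x : (normsq x == 0) = (x == 0).
Proof.
apply/idP/idP => [|/eqP ->]; last by rewrite /normsq mulmx0 mxE.
rewrite normsqE psumr_eq0 => [/allP h|i _]; last exact: sqr_ge0.
apply/eqP/colP => i; rewrite [RHS]mxE; apply/eqP.
by have := h i; rewrite mem_index_enum sqrf_eq0; apply.
Qed.

Lemma normsq_gt0 x : x != 0 -> 0 < normsq x.
Proof. by move=> x0; rewrite lt0r normsq_eq0 x0 normsq_ge0. Qed.

Lemma quad_form_eigenvector M x p : M *m x = p *: x ->
  quad_form M x = p * normsq x.
Proof. by move=> Mx; rewrite /quad_form -mulmxA Mx -scalemxAr mxE. Qed.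

Lemma eigenvector_of_eigenvalue M l i : M^T = M -> eigenvalues_of M l ->
  exists2 x : 'cV[R]_n, x != 0 & M *m x = l i *: x.
Proof.
move=> Msym Ml.
have : root (char_poly M) (l i).
  rewrite [char_poly M]Ml; apply/rootP; rewrite horner_prod (bigD1 i)//=.
  by rewrite hornerXsubC subrr mul0r.
rewrite -eigenvalue_root_char => /eigenvalueP[v vM v0].
exists v^T; first by rewrite -trmx0 (inj_eq (@trmx_inj _ _ _)).
by rewrite -{1}Msym -trmx_mul vM linearZ.
Qed.

(** The characteristic polynomial is homogeneous jointly in ['X] and the matrix;
    for [g != 0] this is read off by substituting [g^-1 *: 'X] for ['X]. *)
Lemma char_poly_scale g M l : eigenvalues_of M l ->
  eigenvalues_of (g *: M) (fun i => g * l i).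
Proof.
rewrite /eigenvalues_of => Ml; have [->|g0] := eqVneq g 0.
  rewrite scale0r char_poly_trig; last by apply/is_trig_mxP => i j _; rewrite mxE.
  by apply: eq_bigr => i _; rewrite mul0r mxE.
have -> : char_poly (g *: M) = \det (g%:P *: map_mx (comp_poly (g^-1 *: 'X)) (char_poly_mx M)).
  congr (\det _); apply/matrixP => i j; rewrite !mxE.
  rewrite rmorphB/= rmorphMn/= comp_polyX comp_polyC mulrBr -polyCM; congr (_ - _).
  by rewrite mulrnAr mul_polyC scalerA divff// scale1r.
rewrite detZ det_map_mx -/(char_poly M) Ml rmorph_prod/=.
have -> : g%:P ^+ n = \prod_(i < n) g%:P by rewrite prodr_const card_ord.
rewrite -big_split/=; apply: eq_bigr => i _.
rewrite rmorphB/= comp_polyX comp_polyC mulrBr -polyCM; congr (_ - _).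
by rewrite mul_polyC scalerA divff// scale1r.
Qed.

(** Both sides are the determinant of the bordered matrix [[z I, u; v, 1]]
    (times [z]), reduced by column operations that clear the last row, for the
    left-hand side, or the last column, for the right-hand side. *)
Lemma det_rank1 (S : comPzRingType) (z : S) (u : 'cV[S]_n) (v : 'rV[S]_n) :
  z * \det (z%:M - u *m v) = z ^+ n * (z - (v *m u) ord0 ord0).
Proof.
pose L : 'M[S]_(n + 1) := block_mx 1%:M 0 (- v) 1%:M.
pose U : 'M[S]_(n + 1) := block_mx 1%:M (- u) 0 z%:M.
have detL : \det L = 1.
  rewrite /L det_lblock; apply: etrans (mulr1 _).
  by congr (_ * _); exact: det1.
have detU : \det U = z.
  rewrite /U det_ublock; apply: etrans (mul1r _).
  by congr (_ * _); [exact: det1|exact: det_scalar1].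
pose B : 'M[S]_(n + 1) := block_mx z%:M u v 1%:M.
have BL : \det B = \det (z%:M - u *m v).
  rewrite -[LHS]mulr1 -detL -det_mulmx /B /L mulmx_block.
  rewrite !mulmx1 !mulmx0 mul1mx mulmxN !add0r subrr det_ublock.
  by apply: etrans (mulr1 _); congr (_ * _); exact: det1.
have BU : \det B * z = z ^+ n * (z - (v *m u) ord0 ord0).
  rewrite -detU -det_mulmx /B /U mulmx_block.
  rewrite !mulmx1 !mulmx0 mul1mx !mulmxN addr0.
  rewrite mul_scalar_mx mul_mx_scalar addNr det_lblock det_scalar.
  by rewrite det_mx11 !mxE eqxx mulr1n addrC detU.
by rewrite -BL mulrC.
Qed.

(** On the eigenvector [x] of [A], the matrix ['X - g A] acts as multiplication
    by [z = 'X - g a_i].  Hence [z ('X - B)] factors as ['X - g A] times [z]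
    perturbed by a rank-one matrix, whose determinant is [det_rank1]. *)
Lemma eigenvalues_of_rank1 A a x i g c : eigenvalues_of A a ->
  A *m x = a i *: x ->
  eigenvalues_of (g *: A + c *: (x *m x^T))
    (fun j => if j == i then g * a i + c * normsq x else g * a j).
Proof.
move=> Aa Ax; rewrite /eigenvalues_of; set B := _ + _.
pose z : {poly R} := 'X - (g * a i)%:P.
pose x' := map_mx polyC x.
have z0 : z != 0 by rewrite polyXsubC_eq0.
pose u := c%:P *: x'; pose M := char_poly_mx (g *: A).
have Mu : M *m u = z *: u.
  rewrite -scalemxAr scalerA mulrC -scalerA; congr (_ *: _).
  rewrite mulmxBl mul_scalar_mx scalerBl; congr (_ - _).
  rewrite -map_mxM -scalemxAl Ax scalerA.
  exact: map_mxZ.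
have MB : M *m (z%:M - u *m x'^T) = z *: char_poly_mx B.
  rewrite mulmxBr mul_mx_scalar mulmxA Mu -scalemxAl -scalerBr; congr (_ *: _).
  rewrite /M /char_poly_mx -addrA; congr (_ + _).
  apply/matrixP => k j; rewrite /u /x' !mxE !big_ord1 !mxE polyCD !polyCM; ring.
have := congr1 determinant MB; rewrite det_mulmx detZ -/(char_poly _).
move/(congr1 (fun y => z * y)); rewrite mulrCA det_rank1 mulrCA [X in _ = X]mulrCA.
move/(mulfI (expf_neq0 n z0)); rewrite [RHS]mulrC mulrC => e.
apply: (mulfI z0); rewrite mulrC.
transitivity (z * char_poly B); first by rewrite mulrC.
rewrite mulrC in e.
rewrite mulrC -e (char_poly_scale g Aa) (bigD1 i)//= [in RHS](bigD1 i)//= eqxx.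
rewrite -/z -mulrA; congr (_ * _).
rewrite [LHS]mulrC; congr (_ * _); last first.
  by apply: eq_bigr => j /negPf ->.
rewrite /z polyCD opprD addrA; congr (_ - _).
rewrite -scalemxAr mxE polyCM; congr (_ * _).
by rewrite /x' map_trmx -map_mxM mxE.
Qed.

Lemma eigenvalues_of_unique M l a : eigenvalues_of M l -> eigenvalues_of M a ->
  (forall f : R -> R, \sum_i f (l i) = \sum_i f (a i)) /\
  (forall j, exists k, a j = l k).
Proof.
move=> Ml Ma.
have e : perm_eq [seq l i | i <- index_enum 'I_n] [seq a i | i <- index_enum 'I_n].
  by apply: prod_XsubC_eq; rewrite !big_map -Ml -Ma.
split => [f|j].
  transitivity (\sum_(y <- [seq l i | i <- index_enum 'I_n]) f y); first by rewrite big_map.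
  by rewrite (perm_big _ e) big_map.
have : a j \in [seq a i | i <- index_enum 'I_n].
  by apply: map_f; rewrite mem_index_enum.
by rewrite -(perm_mem e) => /mapP[k _ ->]; exists k.
Qed.

Lemma eigenvalues_ge0 M l : M^T = M -> eigenvalues_of M l -> pos_semidef M ->
  forall i, 0 <= l i.
Proof.
move=> Msym Ml Mpsd i; have [x x0 Mx] := eigenvector_of_eigenvalue i Msym Ml.
by have := Mpsd x; rewrite (quad_form_eigenvector Mx) pmulr_lge0// normsq_gt0.
Qed.

Lemma eigenvalues_gt0 M l : M^T = M -> eigenvalues_of M l -> pos_def M ->
  forall i, 0 < l i.
Proof.
move=> Msym Ml Mpd i; have [x x0 Mx] := eigenvector_of_eigenvalue i Msym Ml.
by have := Mpd x x0; rewrite (quad_form_eigenvector Mx) pmulr_lgt0// normsq_gt0.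
Qed.

End LinearAlgebra.

(** A symmetric [P] with [P * P = 0] is zero, as the diagonal of [P * P] consists
    of the squared norms of the columns of [P]; halve the exponent repeatedly. *)
Lemma symmetric_nilpotent (R : realType) n (N : 'M[R]_n.+1) k :
  N^T = N -> N ^+ k = 0 -> N = 0.
Proof.
move=> Nsym Nk.
have Psym j : (N ^+ j)^T = N ^+ j.
  elim: j => [|j IH]; first by rewrite expr0 trmx1.
  by rewrite exprS -[_ * _]/(_ *m _) trmx_mul IH Nsym -[_ *m _]/(_ * _) -exprSr exprS.
have : N ^+ (2 ^ k) = 0.
  by rewrite -(subnK (ltnW (ltn_expl k (isT : (1 < 2)%N)))) exprD Nk mulr0.
elim: k {Nk} => [|k IH]; first by rewrite expn0 expr1.
rewrite expnS mul2n -addnn exprD => PP; apply: IH; apply/matrixP => i j.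
set P := N ^+ (2 ^ k).
have : normsq (col j P) == 0.
  have /matrixP/(_ j j) := PP; rewrite normsqE !mxE => PPjj.
  apply/eqP; rewrite -[RHS]PPjj; apply: eq_bigr => m _.
  have -> : (N ^+ (2 ^ k)) j m = (N ^+ (2 ^ k)) m j by rewrite -[in RHS](Psym (2 ^ k)%N) mxE.
  by rewrite mxE expr2.
by rewrite normsq_eq0 => /eqP/colP/(_ i); rewrite !mxE.
Qed.

(** By the Cayley-Hamilton theorem [A - p] is nilpotent. *)
Lemma symmetric_single_eigenvalue (R : realType) n (A : 'M[R]_n) l p :
  A^T = A -> eigenvalues_of A l -> (forall i, l i = p) -> A = p%:M.
Proof.
case: n A l => [|n] A l Asym Al lp; first by apply/matrixP => -[].
apply/eqP; rewrite -subr_eq0; apply/eqP; apply: (@symmetric_nilpotent _ _ _ n.+1).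
  by rewrite linearB/= Asym tr_scalar_mx.
have := Cayley_Hamilton A; rewrite [char_poly A]Al.
under eq_bigr do rewrite lp.
rewrite prodr_const card_ord rmorphXn/= rmorphB/= horner_mx_X horner_mx_C.
by [].
Qed.

(** * Radial functions: from the punctured space to the half-line *)

Section Calculus.
Context {R : realType}.

Lemma is_derive_line (V : normedModType R) (f : V -> R) x v d :
  is_derive x v f d <-> is_derive (0 : R) 1 (fun t : R => f (t *: v + x)) d.
Proof.
have dE : 'D_v f x = 'D_1 (fun t : R => f (t *: v + x)) 0.
  rewrite /derive; set g1 := fun h => h^-1 *: _; set g2 := fun h => h^-1 *: _.
  suff -> : g1 = g2 by [].
  by apply/funext => h; rewrite /g1 /g2 /= addr0 scale0r add0r [_%:A]mulr1.
split=> -[df <-]; first by rewrite dE; apply: DeriveDef => //; exact/(derivable1P f x v).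
by rewrite -dE; apply: DeriveDef => //; exact/(derivable1P f x v).
Qed.

Lemma near_neq0 n (x : 'cV[R]_n) : x != 0 -> \forall y \near x, y != 0.
Proof.
move=> x0; have c0 : closed [set 0 : 'cV[R]_n].
  by apply: accessible_closed_set1; apply: hausdorff_accessible; exact: norm_hausdorff.
have /= : nbhs x (~` [set 0 : 'cV[R]_n]).
  apply: open_nbhs_nbhs; split; first exact: closed_openC.
  by move=> /= x00; move: x0; rewrite x00 eqxx.
by apply: filterS => y /= /eqP.
Qed.

End Calculus.

Definition half_quad_form (R : realType) n (A : 'M[R]_n) (x : 'cV[R]_n) : R :=
  2^-1 * quad_form A x.

Section Radial.
Context {R : realType} {n : nat}.
Variable A : 'M[R]_n.
Hypotheses (Asym : A^T = A) (Apos : pos_def A).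
Implicit Types x v : 'cV[R]_n.

Let entryZ k (M : 'M[R]_1) : (k *: M) ord0 ord0 = k * M ord0 ord0.
Proof. by rewrite mxE. Qed.

Let entryD (M N : 'M[R]_1) : (M + N) ord0 ord0 = M ord0 ord0 + N ord0 ord0.
Proof. by rewrite mxE. Qed.

Local Notation q := (half_quad_form A).

Lemma half_quad_form_gt0 x : x != 0 -> 0 < q x.
Proof. by move=> x0; rewrite mulr_gt0 ?invr_gt0 ?Apos. Qed.

Lemma half_quad_formZ c x : q (c *: x) = c ^+ 2 * q x.
Proof.
by rewrite /half_quad_form /quad_form [(_ *: _)^T]linearZ/= -scalemxAr -!scalemxAl !entryZ; ring.
Qed.

Lemma half_quad_form_line (t : R) v x :
  q (t *: v + x) = q x + t * (v^T *m (A *m x)) ord0 ord0 + t ^+ 2 * q v.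
Proof.
have sw : (x^T *m A *m v) ord0 ord0 = (v^T *m (A *m x)) ord0 ord0.
  have -> : x^T *m A *m v = (v^T *m (A *m x))^T.
    by rewrite !trmx_mul trmxK Asym.
  by rewrite mxE.
rewrite /half_quad_form /quad_form [(_ + _)^T]linearD/= [(_ *: _)^T]linearZ/=.
rewrite !mulmxDl !mulmxDr.
rewrite -!scalemxAl -!scalemxAr -!(mulmxA v^T).
by rewrite !entryD !entryZ sw; field.
Qed.

Lemma is_derive_half_quad_form_line v x :
  is_derive (0 : R) 1 (fun t : R => q (t *: v + x)) ((v^T *m (A *m x)) ord0 ord0).
Proof.
set b := (_ *m _) _ _.
have -> : (fun t : R => q (t *: v + x)) = (fun t => q x + t * b + t ^+ 2 * q v).
  by apply/funext => t; exact: half_quad_form_line.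
by apply: is_derive_eq; rewrite /GRing.scale/=; ring.
Qed.

Lemma is_derive_radial (F : R -> R) v x d : is_derive (q x) 1 F d ->
  is_derive x v (F \o q) (d * (v^T *m (A *m x)) ord0 ord0).
Proof.
move=> dF; apply/is_derive_line.
apply: (@is_derive1_comp R F (fun t : R => q (t *: v + x))).
  by rewrite scale0r add0r.
exact: is_derive_half_quad_form_line.
Qed.

(** Along the ray of [x], [F o q] is [F] precomposed with a quadratic function of
    the ray parameter, which has a differentiable inverse away from the origin:
    smoothness on the ray descends to [F]. *)
Lemma derivable_profile (F : R -> R) x (c : R) : x != 0 -> 0 < c ->
  derivable (F \o q) (c *: x) x -> derivable F (q (c *: x)) 1.
Proof.
move=> x0 c0 /derivable1P/derivableP dF.
have qx : 0 < q x by exact: half_quad_form_gt0.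
have s0 : 0 < q (c *: x) by rewrite half_quad_formZ mulr_gt0 ?exprn_gt0.
pose th (s : R) := Num.sqrt (s * (q x)^-1) - c.
have th0 : th (q (c *: x)) = 0.
  by rewrite /th half_quad_formZ mulfK ?gt_eqF// sqrtr_sqr gtr0_norm ?subrr.
have dth : derivable th (q (c *: x)) 1.
  apply: derivableB => //.
  apply: ex_derive; apply: is_derive1_comp.
  by apply: is_derive1_sqrt; rewrite divr_gt0.
have [] : is_derive (q (c *: x)) 1 ((fun t => F (q (t *: x + c *: x))) \o th)
    ('D_1 (fun t : R => F (q (t *: x + c *: x))) 0 * 'D_1 th (q (c *: x))).
  apply: is_derive1_comp; first by rewrite th0.
  exact/derivableP.
move=> + _; apply: near_eq_derivable.
near=> s; rewrite /= -scalerDl half_quad_formZ /th subrK sqr_sqrtr ?divfK ?gt_eqF//.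
rewrite divr_ge0 ?(ltW qx)// ltW//; near: s.
exact: lt_nbhsr.
Unshelve. all: by end_near. Qed.

Hypothesis n0 : (0 < n)%N.
Variables (u : 'cV[R]_n -> R) (U : R -> R).
Hypotheses (uU : forall x, x != 0 -> u x = U (q x)) (uC2 : C2_punctured u).

Let delta_neq0 i : delta_mx i ord0 != 0 :> 'cV[R]_n.
Proof. by apply/eqP => /colP/(_ i)/eqP; rewrite !mxE !eqxx oner_eq0. Qed.

Lemma half_quad_form_onto x (s : R) : x != 0 -> 0 < s ->
  exists c : R, 0 < c /\ q (c *: x) = s.
Proof.
move=> x0 s0; have q0 := half_quad_form_gt0 x0.
exists (Num.sqrt (s / q x)); rewrite sqrtr_gt0 divr_gt0//; split => //.
by rewrite half_quad_formZ sqr_sqrtr ?divfK ?gt_eqF// ltW// divr_gt0.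
Qed.

Lemma profile_is_derive (s : R) : 0 < s -> is_derive s 1 U ('D_1 U s).
Proof.
move=> s0; apply/derivableP; have [c [c0 <-]] := half_quad_form_onto (delta_neq0 (Ordinal n0)) s0.
apply: derivable_profile => //.
have y0 : c *: delta_mx (Ordinal n0) ord0 != 0 :> 'cV[R]_n.
  by rewrite scaler_eq0 negb_or gt_eqF ?delta_neq0.
have [du _ _] := uC2 y0; have := diff_derivable (v := delta_mx (Ordinal n0) ord0) du.
apply: near_eq_derivable; near=> y; apply: uU; near: y.
exact: near_neq0.
Unshelve. all: by end_near. Qed.

Lemma pderiv_radial i x : x != 0 -> pderiv u i x = 'D_1 U (q x) * (A *m x) i ord0.
Proof.
move=> x0; rewrite /pderiv.
have -> : 'D_(delta_mx i ord0) u x = 'D_(delta_mx i ord0) (U \o q) x.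
  apply: near_eq_derive; near=> y; apply: uU; near: y; exact: near_neq0.
have [_ ->] := is_derive_radial (delta_mx i ord0) (profile_is_derive (half_quad_form_gt0 x0)).
by rewrite trmx_delta -rowE mxE.
Unshelve. all: by end_near. Qed.

(** The [i]-th partial derivative of [u] is [U' (q x)] times [(A x)_i].  On the
    [i]-th axis the second factor is nonzero, because [A i i > 0], so [U'] is a
    quotient of differentiable functions there. *)
Lemma profile_derivable2 (s : R) : 0 < s -> derivable (fun s => 'D_1 U s) s 1.
Proof.
move=> s0; pose i := Ordinal n0; have [c [c0 <-]] := half_quad_form_onto (delta_neq0 i) s0.
pose e : 'cV[R]_n := delta_mx i ord0; rewrite -/e.
have y0 : c *: e != 0 by rewrite scaler_eq0 negb_or gt_eqF ?delta_neq0.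
have Aii : (A *m e) i ord0 != 0.
  have := Apos (delta_neq0 i).
  by rewrite /quad_form -mulmxA trmx_delta -rowE mxE => /gt_eqF ->.
apply: derivable_profile => //; first exact: delta_neq0.
apply/derivable1P.
have : derivable (fun t : R => pderiv u i (t *: e + c *: e) * ((t + c) * (A *m e) i ord0)^-1) 0 1.
  apply: derivableM.
    apply: (proj1 (derivable1P (pderiv u i) (c *: e) e)); apply: diff_derivable.
    by have [_ + _] := uC2 y0; apply.
  apply: derivableV; first by rewrite /= add0r mulf_neq0// gt_eqF.
  exact: ex_derive.
apply: near_eq_derivable; near=> t.
have tc : t + c != 0.
  rewrite gt_eqF// -ltrBlDr sub0r; near: t; apply: lt_nbhsr.
  by rewrite oppr_lt0.
rewrite -scalerDl pderiv_radial ?scaler_eq0 ?negb_or ?tc ?delta_neq0//.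
have -> : (A *m ((t + c) *: e)) i ord0 = (t + c) * (A *m e) i ord0.
  by rewrite -scalemxAr mxE.
by rewrite mulfK// mulf_neq0.
Unshelve. all: by end_near. Qed.

Lemma hessian_radial x : x != 0 ->
  hessian u x = 'D_1 U (q x) *: A +
    'D_1 (fun s => 'D_1 U s) (q x) *: ((A *m x) *m (A *m x)^T).
Proof.
move=> x0; apply/matrixP => i j; rewrite !mxE big_ord1 !mxE.
pose e : 'cV[R]_n := delta_mx j ord0.
pose h := (fun y => 'D_1 U (q y)) * (fun y : 'cV[R]_n => (A *m y) i ord0).
have -> : pderiv (pderiv u i) j x = 'D_e h x.
  rewrite /pderiv -/e; apply: near_eq_derive; near=> y; apply: pderiv_radial; near: y.
  exact: near_neq0.
have dg := is_derive_radial e (derivableP (profile_derivable2 (half_quad_form_gt0 x0))).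
have dl : is_derive x e (fun y : 'cV[R]_n => (A *m y) i ord0) (A i j).
  apply/is_derive_line.
  have -> : (fun t : R => (A *m (t *: e + x)) i ord0) = (fun t => t * A i j + (A *m x) i ord0).
    apply/funext => t; rewrite mulmxDr -scalemxAr [LHS]mxE; congr (_ + _).
    by rewrite /e -colE !mxE.
  by apply: is_derive_eq; rewrite /GRing.scale/=; ring.
have [_ ->] := is_deriveM dg dl.
rewrite trmx_delta -rowE [X in _ + _ *: (_ * X)]mxE /GRing.scale/= !mxE; ring.
Unshelve. all: by end_near. Qed.

(** The point [x] is the eigenvector of [A] for [a i], scaled so that its value
    of [q] is [s]; then [a i * normsq x = 2 * s], and the rank-one coefficient
    [k * a i ^+ 2] becomes [2 * s * k * a i]. *)
Lemma hessian_radial_eigenvalues (a : 'I_n -> R) i (s : R) :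
  eigenvalues_of A a -> 0 < s ->
  let g := 'D_1 U s in let k := 'D_1 (fun s => 'D_1 U s) s in
  exists x, [/\ x != 0, (hessian u x)^T = hessian u x &
    eigenvalues_of (hessian u x)
      (fun j => if j == i then a i * (g + 2 * s * k) else g * a j)].
Proof.
move=> Aa s0 g k; have [v v0 Av] := eigenvector_of_eigenvalue i Asym Aa.
have [c [c0 qs]] := half_quad_form_onto v0 s0.
have x0 : c *: v != 0 by rewrite scaler_eq0 negb_or gt_eqF.
have Ax : A *m (c *: v) = a i *: (c *: v).
  by rewrite -scalemxAr Av !scalerA mulrC.
have hE : hessian u (c *: v) = g *: A + (k * a i ^+ 2) *: ((c *: v) *m (c *: v)^T).
  rewrite (hessian_radial x0) qs -/g -/k; congr (_ + _).
  by rewrite Ax [X in _ *m X]linearZ/= -scalemxAl -scalemxAr !scalerA expr2 mulrA.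
exists (c *: v); split => //.
  rewrite hE linearD/= [(_ *: A)^T]linearZ/= Asym; congr (_ + _).
  by rewrite linearZ/= trmx_mul trmxK.
rewrite hE; have := eigenvalues_of_rank1 g (k * a i ^+ 2) Aa Ax.
congr eigenvalues_of; apply/funext => j; case: eqP => // _.
have qE : q (c *: v) = 2^-1 * (a i * normsq (c *: v)).
  by rewrite /half_quad_form (quad_form_eigenvector Ax).
by rewrite -qs qE; field.
Qed.

End Radial.

(** * The radial Monge-Ampere equation *)

Section PositiveHalfLine.
Context {R : realType}.
Implicit Types (f g : R -> R).

Lemma is_derive0_constant_pos f : (forall x : R, 0 < x -> is_derive x 1 f 0) ->
  forall x y : R, 0 < x -> 0 < y -> f x = f y.
Proof.
move=> df x y; wlog xy : x y / x <= y.
  by move=> H x0 y0; case: (leP x y) => [/H->//|/ltW/H->].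
move=> x0 y0.
have df' z : z \in `[x, y]%R -> is_derive z 1 f 0.
  by rewrite in_itv/= => /andP[xz _]; apply: df; exact: lt_le_trans xz.
have fc : {within `[x, y], continuous f}.
  by apply: derivable_within_continuous => z /df'[].
have df_oo z : z \in `]x, y[%R -> is_derive z 1 f ((fun=> 0) z).
  by move=> zxy; apply: df'; exact: subset_itv_oo_cc.
have [z _] := MVT_segment xy df_oo fc.
by rewrite mul0r => /eqP; rewrite subr_eq0 => /eqP.
Qed.

Lemma constant_slope f c : (forall x : R, 0 < x -> is_derive x 1 f c) ->
  exists d, forall x : R, 0 < x -> f x = c * x + d.
Proof.
move=> df; exists (f 1 - c) => x x0.
have : forall x : R, 0 < x -> is_derive x 1 (fun x => f x - c * x) 0.
  move=> y y0; have dfy := df y y0.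
  by apply: is_derive_eq; rewrite /GRing.scale/=; ring.
move/is_derive0_constant_pos/(_ x 1 x0 ltr01) => /eqP.
by rewrite subr_eq => /eqP ->; ring.
Qed.

Section RadialMongeAmpere.
Variables (n : nat) (U g k : R -> R).
Hypothesis n0 : (0 < n)%N.
Hypotheses (dU : forall s : R, 0 < s -> is_derive s 1 U (g s))
  (dg : forall s : R, 0 < s -> is_derive s 1 g (k s))
  (g0 : forall s, 0 < s -> 0 < g s)
  (ode : forall s, 0 < s -> g s ^+ n.-1 * (g s + 2 * s * k s) = 1).

(** The derivative of the profile [r |-> U (r ^+ 2 / 2)] in the radial variable. *)
Let slope (r : R) := r * g (2^-1 * r ^+ 2).

Let half_sqr_gt0 (r : R) : 0 < r -> 0 < 2^-1 * r ^+ 2.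
Proof. by move=> r0; rewrite mulr_gt0 ?exprn_gt0. Qed.

Let is_derive_half_sqr (r : R) : is_derive r 1 (fun r : R => 2^-1 * r ^+ 2) r.
Proof. by apply: is_derive_eq; rewrite /GRing.scale/=; field. Qed.

Lemma is_derive_radial_profile (r : R) : 0 < r ->
  is_derive r 1 (fun r => U (2^-1 * r ^+ 2)) (slope r).
Proof.
move=> r0; rewrite /slope mulrC; apply: is_derive1_comp (is_derive_half_sqr r).
exact/dU/half_sqr_gt0.
Qed.

Lemma slope_gt0 (r : R) : 0 < r -> 0 < slope r.
Proof. by move=> r0; rewrite mulr_gt0 ?g0// half_sqr_gt0. Qed.

(** The derivative of [slope r ^+ n - r ^+ n] is the defect of the equation times
    [n * r ^+ n.-1].  A negative constant would make [slope r ^+ n] nonpositive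
    for small [r]. *)
Lemma slope_first_integral :
  exists2 c, 0 <= c & forall r : R, 0 < r -> slope r ^+ n = r ^+ n + c.
Proof.
have [c cE] : exists c, forall r : R, 0 < r -> slope r ^+ n - r ^+ n = 0 * r + c.
  apply: constant_slope => r r0; set s := 2^-1 * r ^+ 2.
  have s0 : 0 < s by exact: half_sqr_gt0.
  have dgr : is_derive r 1 (fun r => g (2^-1 * r ^+ 2)) (k s * r).
    by apply: is_derive1_comp (is_derive_half_sqr r); exact: dg.
  have dslope : is_derive r 1 slope (g s + 2 * s * k s).
    by apply: is_derive_eq; rewrite /GRing.scale/= -/s /s; field.
  have dD := is_deriveB (is_deriveX n dslope) (is_deriveX n (is_derive_id r 1)).
  have -> : (fun r : R => slope r ^+ n - r ^+ n) = slope ^+ n - id ^+ n.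
    by apply/funext => y; rewrite !fctE.
  apply: (is_derive_eq dD); rewrite /GRing.scale/= /slope -/s exprMn mulr1.
  transitivity (n%:R * r ^+ n.-1 * (g s ^+ n.-1 * (g s + 2 * s * k s) - 1)).
    ring.
  by rewrite ode// subrr mulr0.
exists c => [|r r0]; last by rewrite -(subrK (r ^+ n) (_ ^+ _)) cE// mul0r add0r addrC.
rewrite leNgt; apply/negP => cN.
(* As [r <= 1], [r ^+ n <= r <= - c]. *)
pose r := Num.min 1 (- c).
have r0 : 0 < r by rewrite lt_min ltr01 oppr_gt0.
have : 0 < slope r ^+ n by rewrite exprn_gt0// slope_gt0.
rewrite -(subrK (r ^+ n) (_ ^+ _)) cE// mul0r add0r ltNge => /negP; apply.
rewrite addrC -lerBrDr sub0r; apply: (@le_trans _ _ r); last by rewrite ge_min lexx orbT.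
by rewrite -[leRHS]expr1; apply: ler_wiXn2l; rewrite // ?(ltW r0)// ge_min lexx.
Qed.

Lemma root_integrable (c u : R) : 0 <= c -> 0 <= u ->
  (@lebesgue_measure R).-integrable `[0, u] (EFin \o (fun r : R => (r ^+ n + c) `^ (n%:R^-1))).
Proof.
move=> c0 u0; apply: measurable_bounded_integrable => //=.
- by rewrite lebesgue_measure_itv/=; case: ifPn => _; rewrite ?ltry// -EFinB ltry.
- apply: measurable_funTS; apply: (measurableT_comp (measurable_powR _)).
  by apply: measurable_funD => //; exact: measurable_funX.
- exists ((u ^+ n + c) `^ (n%:R^-1)); split; first exact: num_real.
  move=> M Mu r /=; rewrite in_itv/= => /andP[r0 ru].
  rewrite ger0_norm ?powR_ge0//; apply: le_trans (ltW Mu).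
  apply: ge0_ler_powR; rewrite ?invr_ge0 ?nnegrE ?addr_ge0 ?exprn_ge0//.
  by rewrite lerD2r lerXn2r.
Qed.

Lemma root_continuous (c r : R) : 0 <= c -> 0 < r ->
  {for r, continuous (fun r : R => (r ^+ n + c) `^ (n%:R^-1))}.
Proof.
move=> c0 r0; apply/differentiable_continuous/derivable1_diffP.
have din : derivable (fun r : R => r ^+ n + c) r 1.
  by apply: derivableD => //; exact: exprn_derivable.
have pos : 0 < r ^+ n + c by apply: ltr_pwDl => //; exact: exprn_gt0.
have [] // := @is_derive1_comp R (@powR R ^~ (n%:R^-1)) (fun r : R => r ^+ n + c) r _ _
  (is_derive1_powR n%:R^-1 pos) (derivableP din).
Qed.

Lemma radial_monge_ampere_solution : exists c1 c2, 0 <= c1 /\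
  forall r : R, 0 < r -> U (2^-1 * r ^+ 2) =
    \int[lebesgue_measure]_(t in `[0, r]) ((t ^+ n + c1) `^ (n%:R^-1)) + c2.
Proof.
have [c1 c1_ge0 slopeE] := slope_first_integral.
pose I (r : R) := \int[@lebesgue_measure R]_(t in `[0, r]) ((t ^+ n + c1) `^ (n%:R^-1)).
have dI (r : R) : 0 < r -> is_derive r 1 I (slope r).
  move=> r0.
  have r1 : r < r + 1 by rewrite ltrDl.
  have iu := root_integrable c1_ge0 (ltW (lt_trans r0 r1)).
  have [dF dE] := continuous_FTC1_closed r1 iu r0 (root_continuous c1_ge0 r0).
  apply: DeriveDef => //; rewrite -derive1E dE -slopeE//.
  rewrite -powR_mulrn ?ltW ?slope_gt0// -powRrM divff ?pnatr_eq0 -?lt0n//.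
  by rewrite powRr1// ltW// slope_gt0.
have [c2 c2E] : exists c2, forall r : R, 0 < r -> U (2^-1 * r ^+ 2) - I r = 0 * r + c2.
  apply: constant_slope => r r0.
  have d1 := dI _ r0; have d2 := is_derive_radial_profile r0.
  by apply: is_derive_eq; rewrite subrr.
exists c1, c2; split => // r r0.
by rewrite -(subrK (I r) (U _)) c2E// mul0r add0r addrC.
Qed.

End RadialMongeAmpere.

End PositiveHalfLine.

(** * Rigidity of the profile for a matrix with two distinct eigenvalues *)

(** The common features of the functions [f] whose sum over the eigenvalues
    gives the operator, on their domain [D].  The last clause is the
    outcome of comparing the equations along two eigenvectors of [A] with
    eigenvalues [p] and [q]; its second alternative only occurs for the
    arctangent, with [K = pi / 2]. *)
Record rigid_density (R : realType) (D : pred R) (f : R -> R) (K : R) : Prop := {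
  density_pos : forall x, 0 < x -> D x;
  density_scale : forall c x, 0 < c -> D (c * x) = D x;
  density_mono : forall x y, D x -> D y -> x < y -> f x < f y;
  density_rigid : forall p q g m, 0 < p -> 0 < q -> p != q -> D g -> D m ->
    f (p * m) - f (p * g) = f (q * m) - f (q * g) ->
    m = g \/ f (p * m) + f (q * g) = K }.

Section Rigidity.
Context {R : realType} {n : nat}.
Variables (D : pred R) (f : R -> R) (K : R) (a : 'I_n -> R).
Hypotheses (n3 : (3 <= n)%N) (fD : rigid_density D f K) (a0 : forall i, 0 < a i).

Lemma density_sum_inj (P : pred 'I_n) x y : [exists i, P i] -> D x -> D y ->
  \sum_(i | P i) f (x * a i) = \sum_(i | P i) f (y * a i) -> x = y.
Proof.
move=> /existsP[i0 Pi0]; wlog xy : x y / x < y.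
  move=> H Dx Dy e; case: (ltgtP x y) => // [/H->//|/H H']; exact/esym/H'.
move=> Dx Dy e; have : \sum_(i | P i) f (x * a i) < \sum_(i | P i) f (y * a i).
  apply: ltr_sum => [|i _].
    by apply/hasP; exists i0; rewrite ?mem_index_enum.
  by apply: (density_mono fD); rewrite ?ltr_pM2r// mulrC (density_scale fD).
by rewrite e ltxx.
Qed.

Section Pointwise.
Variables (i1 i2 : 'I_n) (g m : R).
Hypotheses (a12 : a i1 != a i2) (Dg : D g) (Dm : D m).
Hypothesis sum_eq : forall i,
  \sum_j f (if j == i then a i * m else g * a j) = \sum_j f (a j).

Let sum_eq1 i : f (a i * m) + \sum_(j | j != i) f (g * a j) = \sum_j f (a j).
Proof.
rewrite -(sum_eq i) [RHS](bigD1 i)//= eqxx; congr (_ + _).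
by apply: eq_bigr => j /negPf ->.
Qed.

Lemma profile_slope_const : m = g -> g = 1.
Proof.
move=> mg; apply: (@density_sum_inj xpredT) => //.
- by apply/existsP; exists i1.
- exact: (density_pos fD).
- under [RHS]eq_bigr do rewrite mul1r.
  by rewrite -(sum_eq1 i1) mg (bigD1 i1)//= [g * a i1]mulrC.
Qed.

(** Comparing the equations for [i1] and [i2] gives the hypothesis of
    [density_rigid].  In its second alternative, substituting [K] in the
    equation for [i1] leaves only the sum over the other indices. *)
Lemma profile_dichotomy :
  g = 1 \/ \sum_(j | (j != i1) && (j != i2)) f (g * a j) = \sum_j f (a j) - K.
Proof.
have i21 : i2 != i1 by apply: contraNneq a12 => ->.
have e1 := sum_eq1 i1; have e2 := sum_eq1 i2.
rewrite (bigD1 i2)//= in e1; rewrite (bigD1 i1) 1?eq_sym//= in e2.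
set S := \sum_(j | _ && _) _ in e2.
have eS : \sum_(j | (j != i1) && (j != i2)) f (g * a j) = S.
  by apply: eq_bigl => j; rewrite andbC.
rewrite eS in e1 *; move: e1 e2; rewrite ![g * _]mulrC => e1 e2.
have [|mg|<-] := density_rigid fD (a0 i1) (a0 i2) a12 Dg Dm; first by lra.
  by left; exact: profile_slope_const.
by right; rewrite -e1; ring.
Qed.

End Pointwise.

(** If [g s != 1], the dichotomy and the injectivity of the sum over the indices
    other than [i1] and [i2] leave [1] and [g s] as the only values of [g].
    Differentiating [(g - 1) (g - g s) = 0] at [s] gives [k s = 0], so that
    [profile_slope_const] applies at [s]. *)
Lemma profile_slope_eq1 (g k : R -> R) i1 i2 : a i1 != a i2 ->
  (forall s : R, 0 < s -> is_derive s 1 g (k s)) ->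
  (forall s, 0 < s -> D (g s)) ->
  (forall s, 0 < s -> D (g s + 2 * s * k s)) ->
  (forall s, 0 < s -> forall i,
    \sum_j f (if j == i then a i * (g s + 2 * s * k s) else g s * a j) =
    \sum_j f (a j)) ->
  forall s, 0 < s -> g s = 1.
Proof.
move=> a12 dg Dg Dm sum_eq s s0; apply/eqP/negPn/negP => g1.
have dich t (t0 : 0 < t) := profile_dichotomy a12 (Dg t t0) (Dm t t0) (sum_eq t t0).
have third : [exists j, (j != i1) && (j != i2)].
  apply/existsP; have := cardC (pred2 i1 i2); rewrite card_ord => cE.
  have /card_gt0P[j] : (0 < #|predC (pred2 i1 i2)|)%N.
    by rewrite -(ltn_add2l #|pred2 i1 i2|) addn0 cE (leq_ltn_trans _ n3)// card2; case: (i1 != i2).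
  by rewrite !inE negb_or => ?; exists j.
have [/eqP|es] := dich s s0; first by rewrite (negPf g1).
have two t : 0 < t -> (g t - 1) * (g t - g s) = 0.
  move=> t0; have [->|et] := dich t t0; first by rewrite subrr mul0r.
  rewrite (@density_sum_inj _ (g t) (g s) third) ?Dg ?subrr ?mulr0//.
  by rewrite et es.
have k0 : k s = 0.
  have dgs := dg s s0.
  have dp : is_derive s 1 (fun t => (g t - 1) * (g t - g s)) ((g s - 1) * k s).
    by apply: is_derive_eq; rewrite /GRing.scale/=; ring.
  have : is_derive s 1 (fun t => (g t - 1) * (g t - g s)) 0.
    apply: (near_eq_is_derive _ (is_derive_cst 0 s 1)).
    near=> t; rewrite two//; near: t; exact: lt_nbhsr.
  case=> _; case: dp => _ -> /eqP; rewrite mulf_eq0 subr_eq0 (negPf g1)/=.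
  by move/eqP.
move/eqP: g1; apply.
apply: (profile_slope_const i1 (Dg s s0) (sum_eq s s0)).
by rewrite k0 mulr0 addr0.
Unshelve. all: by end_near. Qed.

End Rigidity.

(** * The densities of the operators *)

Section Densities.
Context {R : realType}.
Implicit Types (tau b x y : R).

(** The rigidity clause amounts to [2 b (p - q) (m - g) = 0] after exponentiating
    and clearing denominators. *)
Lemma ln_ratio_rigid b : 0 < b ->
  rigid_density (fun x => 0 < x) (fun x => ln (x / (x + 2 * b))) 0.
Proof.
move=> b0.
have den x : 0 < x -> 0 < x + 2 * b by move=> x0; rewrite addr_gt0// mulr_gt0.
have ratio x : 0 < x -> 0 < x / (x + 2 * b) by move=> x0; rewrite divr_gt0// den.
split => [//|c x c0|x y x0 y0 xy|p q g m p0 q0 pq g0 m0 /= e].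
- by rewrite pmulr_rgt0.
- rewrite ltr_ln ?posrE ?ratio//.
  rewrite ltr_pdivrMr ?den// mulrAC ltr_pdivlMr ?den//.
  nra.
have pm := mulr_gt0 p0 m0; have pg := mulr_gt0 p0 g0.
have qm := mulr_gt0 q0 m0; have qg := mulr_gt0 q0 g0.
left; have {}e : (p * m / (p * m + 2 * b)) * (q * g / (q * g + 2 * b)) =
    (q * m / (q * m + 2 * b)) * (p * g / (p * g + 2 * b)).
  apply: ln_inj; rewrite ?posrE ?(mulr_gt0 (ratio _ _) (ratio _ _))//.
  by rewrite [LHS]lnM ?posrE ?ratio// [RHS]lnM ?posrE ?ratio//; move: e; lra.
have dpm := lt0r_neq0 (den _ pm); have dpg := lt0r_neq0 (den _ pg).
have dqm := lt0r_neq0 (den _ qm); have dqg := lt0r_neq0 (den _ qg).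
have {}e : (q * m + 2 * b) * (p * g + 2 * b) = (p * m + 2 * b) * (q * g + 2 * b).
  move: e; rewrite mulf_div [RHS]mulf_div => /eqP; rewrite eqr_div ?mulf_neq0//.
  rewrite (_ : q * m * (p * g) = p * m * (q * g)); last by ring.
  by move/eqP/(mulfI (mulf_neq0 (lt0r_neq0 pm) (lt0r_neq0 qg))).
have : 2 * b * (p - q) * (m - g) = 0 by move: e; lra.
move/eqP; rewrite !mulf_eq0 pnatr_eq0/= gt_eqF//= subr_eq0 (negPf pq)/=.
by rewrite subr_eq0 => /eqP.
Qed.

Lemma opp_inv_rigid : rigid_density (fun x : R => 0 < x) (fun x => - x^-1) 0.
Proof.
split => [//|c x c0|x y x0 y0 xy|p q g m p0 q0 pq g0 m0 /= e].
- by rewrite pmulr_rgt0.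
- by rewrite ltrN2 ltf_pV2.
left; have : (p^-1 - q^-1) * (g^-1 - m^-1) = 0 by move: e; rewrite !invfM; lra.
move/eqP; rewrite mulf_eq0 !subr_eq0 (inj_eq invr_inj) (negPf pq)/=.
by rewrite (inj_eq invr_inj) eq_sym => /eqP.
Qed.

Lemma sin_atan x : sin (atan x) = x * cos (atan x).
Proof.
rewrite -{2}[x]atanK /tan divfK// gt_eqF// cos_gt0_pihalf//.
by rewrite atan_gtNpi2 atan_ltpi2.
Qed.

(** The sine of [(alpha - beta) - (gamma - delta)], for the four arctangents,
    is a positive multiple of [(p - q) (m - g) (1 - p m q g)].  If the last factor
    vanishes, [p m] and [q g] are inverse to each other, and their arctangents
    are complementary. *)
Lemma atan_rigid : rigid_density (fun x : R => 0 <= x) atan (pi / 2).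
Proof.
have cos0 x : cos (atan x) != 0.
  by rewrite gt_eqF// cos_gt0_pihalf// atan_gtNpi2 atan_ltpi2.
split => [x /ltW//|c x c0|x y _ _ xy|p q g m p0 q0 pq g0 m0 /= e].
- by rewrite pmulr_rge0.
- exact: lt_atan.
have : sin (atan (p * m) - atan (p * g)) * cos (atan (q * m) - atan (q * g)) =
       cos (atan (p * m) - atan (p * g)) * sin (atan (q * m) - atan (q * g)).
  by rewrite e mulrC.
rewrite !sinB !cosB !sin_atan.
set c1 := cos _; set c2 := cos _; set c3 := cos _; set c4 := cos _ => e'.
have : c1 * c2 * c3 * c4 * ((p - q) * (m - g) * (1 - (p * m) * (q * g))) = 0.
  by move: e'; lra.
move/eqP; rewrite !mulf_eq0 !(negPf (cos0 _))/= !subr_eq0 (negPf pq)/=.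
case/orP => [/eqP ->|/eqP pmqg]; first by left.
have pm0 : 0 <= p * m by rewrite mulr_ge0// ltW.
have qg0 : 0 <= q * g by rewrite mulr_ge0// ltW.
have at0 x : 0 <= x -> 0 <= atan x by move=> x0; rewrite -[leLHS]atan0 le_atan.
right; apply: cos_inj.
- rewrite in_itv/= addr_ge0 ?at0//=.
  have := atan_ltpi2 (p * m); have := atan_ltpi2 (q * g); lra.
- rewrite in_itv/=; have := pi_ge0 R; lra.
rewrite cos_pihalf cosD !sin_atan; set c5 := cos _; set c6 := cos _.
transitivity (c5 * c6 * (1 - (p * m) * (q * g))); first by ring.
by rewrite -pmqg subrr mulr0.
Qed.

End Densities.

Section Operator.
Context {R : realType}.
Variable tau : R.

Lemma bcoef_gt0 : 0 < tau < pi / 2 -> tau != pi / 4 -> 0 < bcoef tau.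
Proof.
move=> /andP[t0 t2] t4; have pi0 := pi_gt0 R.
have s0 : 0 < sin tau by rewrite sin_gt0_pihalf// t0.
have c0 : 0 < cos tau by rewrite cos_gt0_pihalf// t2 andbT; lra.
rewrite sqrtr_gt0 normr_gt0 subr_eq0 sqrf_eq1 negb_or; apply/andP; split; last first.
  by rewrite gt_eqF// (@lt_trans _ _ 0) ?oppr_lt0// divr_gt0.
apply: contraNneq t4 => /divr1_eq sc.
have : cos tau = cos (pi / 2 - tau).
  by rewrite sc -[in RHS]cosN opprB cosBpihalf.
move/cos_inj; rewrite !in_itv/= => tE; apply/eqP.
have := tE _ _; lra.
Qed.

(** Nonnegativity of the eigenvalues matters for the logarithmic density: the
    formula also makes sense below [- 2 * bcoef tau]. *)
Lemma G_rigid_density n : 0 < tau <= pi / 2 ->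
  exists D f K al be, [/\ rigid_density D f K, al != 0,
    forall l : 'I_n -> R, G_defined tau l -> (forall i, 0 <= l i) -> forall i, D (l i) &
    forall l : 'I_n -> R, G tau l = al * \sum_i f (l i) + be].
Proof.
move=> /andP[t0 t2].
case: (ltgtP tau (pi / 4)) => [t4|t4|t4].
- have b0 : 0 < bcoef tau by apply: bcoef_gt0; [rewrite t0; lra|rewrite lt_eqF].
  exists (fun x => 0 < x), (fun x => ln (x / (x + 2 * bcoef tau))), 0.
  exists (Num.sqrt (ctan tau ^+ 2 + 1) / (2 * bcoef tau)), 0; split.
  + exact: ln_ratio_rigid.
  + by rewrite mulf_neq0 ?invr_eq0 ?mulf_neq0 ?gt_eqF// sqrtr_gt0 ltr_wpDl// sqr_ge0.
  + move=> l; rewrite /G_defined gt_eqF// t4 => lD l0 i.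
    by rewrite lt0r l0 andbT; apply/eqP => li0; have [_] := lD i; rewrite li0 mul0r ltxx.
  + by move=> l; rewrite /G gt_eqF// t4 addr0.
- have nt4 : tau < pi / 4 = false by rewrite ltNge ltW.
  have nt4' : (tau == pi / 4) = false by rewrite gt_eqF.
  exists (fun x => 0 <= x), atan, (pi / 2).
  have [t2'|t2'] := ltP tau (pi / 2).
    have b0 : 0 < bcoef tau by apply: bcoef_gt0; [rewrite t0|rewrite gt_eqF].
    exists (Num.sqrt (ctan tau ^+ 2 + 1) / bcoef tau).
    exists (- (Num.sqrt (ctan tau ^+ 2 + 1) / bcoef tau * (n%:R * pi / 4))); split => //.
    + exact: atan_rigid.
    + by rewrite mulf_neq0 ?invr_eq0 ?gt_eqF// sqrtr_gt0 ltr_wpDl// sqr_ge0.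
    + by move=> l; rewrite /G gt_eqF// nt4 nt4' t2' mulrBr.
  exists 1, 0; split => //; first exact: atan_rigid.
  by move=> l; rewrite /G gt_eqF// nt4 nt4' ltNge t2' mul1r addr0.
- exists (fun x => 0 < x), (fun x => - x^-1), 0, (Num.sqrt 2), 0; split.
  + exact: opp_inv_rigid.
  + by rewrite gt_eqF// sqrtr_gt0.
  + move=> l; rewrite /G_defined gt_eqF// t4 ltxx eqxx => lD l0 i.
    by rewrite lt0r l0 lD.
  + by move=> l; rewrite /G gt_eqF// t4 ltxx eqxx addr0 sumrN mulNr mulrN.
Qed.

Lemma G_scalar n (p C0 : R) : (0 < n)%N -> 0 < p -> 0 < tau ->
  G tau (fun _ : 'I_n => p) = C0 ->
  let a := ctan tau in let b := bcoef tau in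
  [/\ tau < pi / 4 ->
        p = 2 * b / (1 - expR (2 * b / (n%:R * Num.sqrt (a ^+ 2 + 1)) * C0)) - 2 * b,
      tau = pi / 4 -> p = - (Num.sqrt 2 * n%:R / C0),
      pi / 4 < tau < pi / 2 ->
        p = tan (b / (n%:R * Num.sqrt (a ^+ 2 + 1)) * C0 + pi / 4) &
      tau = pi / 2 -> p = tan (C0 / n%:R)].
Proof.
move=> n0 p0 t0 + a b; have nR : n%:R != 0 :> R by rewrite pnatr_eq0 -lt0n.
have pi0 := pi_gt0 R.
have sq : Num.sqrt (a ^+ 2 + 1) != 0 by rewrite gt_eqF// sqrtr_gt0 ltr_wpDl// sqr_ge0.
have nt4 : pi / 4 < tau -> (tau < pi / 4 = false) * ((tau == pi / 4) = false).
  by move=> t4; rewrite ltNge ltW// gt_eqF.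
rewrite /G !sumr_const !card_ord gt_eqF// -/a -/b => H; split.
- move=> t4; move: H; rewrite t4.
  have b0 : 0 < b by apply: bcoef_gt0; [rewrite t0; lra|rewrite lt_eqF].
  have pb : 0 < p + 2 * b by rewrite addr_gt0// mulr_gt0.
  move=> <-; set L := ln _.
  have -> : 2 * b / (n%:R * Num.sqrt (a ^+ 2 + 1)) *
      (Num.sqrt (a ^+ 2 + 1) / (2 * b) * (L *+ n)) = L.
    by rewrite -mulr_natr; field; rewrite nR sq gt_eqF.
  rewrite lnK ?posrE ?divr_gt0//; field.
  by rewrite [p + 2 * b - p](_ : _ = 2 * b) ?mulf_neq0 ?gt_eqF//; ring.
- move=> t4; move: H; rewrite t4 ltxx eqxx => <-.
  rewrite -mulr_natr; field.
  by rewrite nR gt_eqF// gt_eqF// sqrtr_gt0.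
- move=> /andP[t4 t2]; move: H; rewrite !(nt4 t4) t2 => <-.
  have b0 : 0 < b by apply: bcoef_gt0; [rewrite t0|rewrite gt_eqF].
  rewrite -mulr_natr [X in tan X](_ : _ = atan p) ?atanK//.
  by field; rewrite nR sq gt_eqF.
- move=> t2; have t4 : pi / 4 < tau by rewrite t2; lra.
  move: H; rewrite !(nt4 t4) t2 ltxx => <-.
  by rewrite -(mulr_natr (atan p)) mulfK// atanK.
Qed.

End Operator.

(** * The classification *)

Theorem proposition1p5 (R : realType) (n : nat) (hn : (3 <= n)%N)
  (tau : R) (htau : 0 <= tau <= pi / 2) (C0 : R)
  (A : 'M[R]_n) (Asym : A^T = A) (Apos : pos_def A)
  (hA : G_eigenvalues_eq tau A C0)
  (u : 'cV[R]_n -> R) (U : R -> R)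
  (hU : forall x : 'cV[R]_n, x != 0 -> u x = U (2^-1 * quad_form A x))
  (hu : convex_classical_solution tau C0 u) :
  let a := ctan tau in let b := bcoef tau in
  (tau = 0 ->
    exists c1 c2 : R, 0 <= c1 /\
      forall x : 'cV[R]_n, x != 0 ->
        u x = \int[lebesgue_measure]_(r in `[0, Num.sqrt (quad_form A x)])
                ((r ^+ n + c1) `^ (n%:R^-1)) + c2)
  /\
  (0 < tau ->
    [/\ tau < pi / 4 ->
          A = (2 * b / (1 - expR (2 * b / (n%:R * Num.sqrt (a ^+ 2 + 1)) * C0))
               - 2 * b)%:M,
        tau = pi / 4 -> A = (- (Num.sqrt 2 * n%:R / C0))%:M,
        pi / 4 < tau < pi / 2 ->
          A = (tan (b / (n%:R * Num.sqrt (a ^+ 2 + 1)) * C0 + pi / 4))%:M &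
        tau = pi / 2 -> A = (tan (C0 / n%:R))%:M]
    \/
    exists c : R, forall x : 'cV[R]_n, x != 0 ->
      u x = 2^-1 * quad_form A x + c).
Proof.
have n0 : (0 < n)%N by exact: leq_trans hn.
case: hA => l [Al Gl_def Gl]; case: hu => uC2 hess.
have l0 := eigenvalues_gt0 Asym Al Apos.
have dU (s : R) : 0 < s -> is_derive s 1 U ('D_1 U s).
  exact: (profile_is_derive Apos n0 hU uC2).
set g := fun s : R => 'D_1 U s in dU; pose k (s : R) := 'D_1 g s.
have dg (s : R) : 0 < s -> is_derive s 1 g (k s).
  by move=> s0; apply/derivableP; exact: (profile_derivable2 Asym Apos n0 hU uC2).
pose m (s : R) := g s + 2 * s * k s.
have spec (s : R) i : 0 < s -> exists nu : 'I_n -> R, [/\ forall j, 0 <= nu j, G_defined tau nu,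
    G tau nu = C0,
    forall f : R -> R, \sum_j f (nu j) =
      \sum_j f (if j == i then l i * m s else g s * l j) &
    forall j, exists q, (if j == i then l i * m s else g s * l j) = nu q].
  move=> s0.
  have [x [x0 xsym xev]] := hessian_radial_eigenvalues Asym Apos n0 hU uC2 i Al s0.
  have [psd [nu [nuE nu_def Gnu]]] := hess x x0.
  have [sumE memE] := eigenvalues_of_unique nuE xev.
  exists nu; split => //; exact: eigenvalues_ge0 xsym nuE psd.
have dom (D : pred R) : (forall c x, 0 < c -> D (c * x) = D x) ->
    (forall nu : 'I_n -> R, G_defined tau nu -> (forall i, 0 <= nu i) ->
      forall i, D (nu i)) ->
    forall s : R, 0 < s -> D (g s) /\ D (m s).
  (* The rank-one term only moves the eigenvalue of index [i], so the one of
     index [j] gives [g s], and the moved one gives [m s]. *)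
  move=> Dscale GD s s0; pose i : 'I_n := Ordinal n0.
  pose j : 'I_n := Ordinal (leq_trans (isT : (1 < 3)%N) hn).
  have [nu [nu0 nu_def _ _ memE]] := spec s i s0.
  have Dnu := GD nu nu_def nu0; split.
    by rewrite -(Dscale (l j)) ?l0// mulrC; have := memE j; rewrite (_ : (j == i) = false)// => -[q ->].
  by rewrite -(Dscale (l i)) ?l0//; have := memE i; rewrite eqxx => -[q ->].
move=> a b; split => [t0|t0].
  have gm0 (s : R) : 0 < s -> 0 < g s /\ 0 < m s.
    apply: (dom (fun x => 0 < x)) => [c x c0|nu]; first exact: pmulr_rgt0.
    by rewrite /G_defined t0 eqxx.
  have ode (s : R) : 0 < s -> g s ^+ n.-1 * (g s + 2 * s * k s) = 1.
    move=> s0; have [gs0 ms0] := gm0 s s0; rewrite -/(m s).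
    have [nu [_ _ Gnu sumE _]] := spec s (Ordinal n0) s0.
    have : \sum_j ln (nu j) = \sum_j ln (l j).
      have nV : n%:R^-1 != 0 :> R by rewrite invr_eq0 pnatr_eq0 -lt0n.
      by apply: (mulfI nV); move: Gnu Gl; rewrite /G t0 eqxx => -> ->.
    rewrite sumE.
    rewrite (eq_bigr (fun j => ln (l j) +
        ln (if j == Ordinal n0 then m s else g s))); last first.
      move=> j _; have := l0 j; case: eqP => [->|_] lj0; first by rewrite lnM.
      by rewrite mulrC lnM.
    rewrite big_split/= => /(canRL (addKr _)); rewrite addNr => sum0.
    apply: ln_inj; rewrite ?posrE ?mulr_gt0 ?exprn_gt0// ln1.
    rewrite lnM ?posrE ?exprn_gt0// lnXn// -sum0 (bigD1 (Ordinal n0))//= addrC.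
    congr (_ + _); rewrite (eq_bigr (fun=> ln (g s))); last by move=> j /negPf ->.
    by rewrite sumr_const cardC1 card_ord.
  have g0 (s : R) : 0 < s -> 0 < g s by move=> /gm0[].
  have [c1 [c2 [c10 UE]]] := radial_monge_ampere_solution n0 dU dg g0 ode.
  exists c1, c2; split => // x x0.
  have qA := Apos x x0.
  by rewrite hU// -UE ?sqrtr_gt0// sqr_sqrtr// ltW.
have [|D [f [K [al [be [fD al0 GD GE]]]]]] := @G_rigid_density R tau n.
  by rewrite t0; case/andP: htau.
have [/forallP lconst|] := boolP [forall i, l i == l (Ordinal n0)].
  left; set p := l _ in lconst.
  have -> : A = p%:M by apply: (symmetric_single_eigenvalue Asym Al) => i; exact/eqP.
  have lE : l = fun=> p by apply/funext => i; exact/eqP.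
  rewrite lE in Gl; have [h1 h2 h3 h4] := G_scalar n0 (l0 (Ordinal n0) : 0 < p) t0 Gl.
  by split => [/h1|/h2|/h3|/h4] <-.
rewrite negb_forall => /existsP[i1 i12]; right.
have g1 : forall s : R, 0 < s -> g s = 1.
  apply: (profile_slope_eq1 hn fD l0 i12 dg) => [s s0|s s0|s s0 i].
  - by have [] := dom D (density_scale fD) GD s s0.
  - by have [] := dom D (density_scale fD) GD s s0.
  have [nu [_ _ Gnu sumE _]] := spec s i s0.
  rewrite -[LHS]sumE; apply: (mulfI al0); apply: (addIr be).
  by rewrite -!GE Gnu Gl.
have [s s0|c cE] := @constant_slope R U 1; first exact: is_derive_eq (dU s s0) (g1 s s0).
exists c => x x0; rewrite hU// cE ?mul1r//.
exact: half_quad_form_gt0.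
Qed.
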